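(* Let $p\in(1,+\infty)$ and let $V\colon\mathbb{R}^2\to\mathbb{R}$ be a $C^1$ positive coercive function with $|\nabla V(x)|\le CV^{3/2}(x)$ for a.e. $x$ and some $C>0$. Let \[ I(u)=\frac12\int_{\mathbb{R}^2}(|\nabla u|^2+V(x)u^2)\,dx-\frac1{p+1}\|u\|_2^2\int_{\mathbb{R}^2}V(x)|u|^{p+1}dx,\qquad u\in H^1_V(\mathbb{R}^2), \] and \[ \mathcal N=\Big\{u\in H^1_V(\mathbb{R}^2): u\ne0,\ \int_{\mathbb{R}^2}(|\nabla u|^2+V(x)u^2)\,dx=\frac{p+3}{p+1}\|u\|_2^2\int_{\mathbb{R}^2}V(x)|u|^{p+1}dx\Big\}. \] Then $\sigma:=\inf_{u\in\mathcal N}I(u)>0$.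
   Context: $H^1_V(\mathbb{R}^2)$ is the completion of $C_0^\infty(\mathbb{R}^2)$ with respect to the norm $\|u\|_V=\left(\int_{\mathbb{R}^2}(|\nabla u|^2+V|u|^2)\,dx\right)^{1/2}$; $\|\cdot\|_2$ is the $L^2$ norm. *)

(* Defs.v *)
From HB Require Import structures.
From mathcomp Require Import all_boot all_order all_algebra.
From mathcomp Require Import all_classical all_reals all_analysis.
Set Implicit Arguments. Unset Strict Implicit. Unset Printing Implicit Defensive.
Import Order.TTheory GRing.Theory Num.Theory.
Import numFieldNormedType.Exports.
Local Open Scope classical_set_scope.
Local Open Scope ring_scope.

Section Defs.
Variable R : realType.

Definition leb2 := ((@lebesgue_measure R) \x (@lebesgue_measure R))%E.

Definition dpart (b : bool) (f : R * R -> R) : R * R -> R :=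
  fun z => if b then derive1 (fun t => f (t, z.2)) z.1
           else derive1 (fun t => f (z.1, t)) z.2.

Definition pderivable (b : bool) (f : R * R -> R) (z : R * R) : Prop :=
  if b then derivable (fun t => f (t, z.2)) z.1 1
  else derivable (fun t => f (z.1, t)) z.2 1.

Definition iterD (s : seq bool) (f : R * R -> R) : R * R -> R := foldr dpart f s.

Definition C1 (f : R * R -> R) : Prop :=
  continuous f /\
  forall b, (forall z, pderivable b f z) /\ continuous (dpart b f).

Definition smooth (f : R * R -> R) : Prop :=
  forall s : seq bool, continuous (iterD s f) /\
    forall b z, pderivable b (iterD s f) z.

Definition Cc_infty (f : R * R -> R) : Prop :=
  smooth f /\ compact (closure (f @^-1` [set~ 0])).

Definition euclid_norm (z : R * R) : R := Num.sqrt (z.1 ^+ 2 + z.2 ^+ 2).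

(* (u, g1, g2) is an element u of H^1_V(R^2) with gradient (g1, g2):
   it is the limit of a sequence of C_0^infinity functions in the norm
   ||.||_V, i.e. an element of the completion. *)
Definition H1V (V : R * R -> R) (u g1 g2 : R * R -> R) : Prop :=
  measurable_fun setT u /\ measurable_fun setT g1 /\ measurable_fun setT g2 /\
  exists phi : nat -> R * R -> R, (forall n, Cc_infty (phi n)) /\
    ((fun n => (\int[leb2]_z
        (((dpart true (phi n) z - g1 z) ^+ 2 + (dpart false (phi n) z - g2 z) ^+ 2
          + V z * (phi n z - u z) ^+ 2)%:E))%E) @ \oo --> 0%E).

Definition normV2 (V : R * R -> R) (u g1 g2 : R * R -> R) : \bar R :=
  (\int[leb2]_z ((g1 z ^+ 2 + g2 z ^+ 2 + V z * u z ^+ 2)%:E))%E.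

Definition L2norm2 (u : R * R -> R) : \bar R := (\int[leb2]_z ((u z ^+ 2)%:E))%E.

Definition Vpow (V : R * R -> R) (p : R) (u : R * R -> R) : \bar R :=
  (\int[leb2]_z ((V z * powR `|u z| (p + 1))%:E))%E.

Definition Ifun (V : R * R -> R) (p : R) (u g1 g2 : R * R -> R) : \bar R :=
  ((2^-1)%:E * normV2 V u g1 g2
   - (p + 1)^-1%:E * (L2norm2 u * Vpow V p u))%E.

Definition Nehari (V : R * R -> R) (p : R) (u g1 g2 : R * R -> R) : Prop :=
  H1V V u g1 g2 /\ ~ (\forall z \ae leb2, u z = 0) /\
  normV2 V u g1 g2 = (((p + 3) / (p + 1))%:E * (L2norm2 u * Vpow V p u))%E.

End Defs.

(* Main.v *)
Require Import Defs.
From HB Require Import structures.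
From mathcomp Require Import all_boot all_order all_algebra.
From mathcomp Require Import all_classical all_reals all_analysis measurable_realfun.
From mathcomp Require Import ring lra.
Set Implicit Arguments. Unset Strict Implicit. Unset Printing Implicit Defensive.
Import Order.TTheory GRing.Theory Num.Theory.
Import numFieldNormedType.Exports.
Local Open Scope classical_set_scope.
Local Open Scope ring_scope.

(** On the Nehari set the functional equals
    [(p + 1) / (2 (p + 3)) * N] with [N := ||u||_V^2], so it suffices to bound
    [N] away from [0].  Coercivity gives [V >= c > 0], whence
    [||u||_2^2 <= N / c], and the point is an estimate
    [\int V |u|^(p+1) <= K N] valid for [N <= 1/4]: the Nehari identity then
    reads [N <= const * N^2].

    For test functions [f] with [N <= 1] the even moments satisfy
    [\int V f^(2n) <= K_n N], by induction on [n].  One applies the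
    Gagliardo-Nirenberg inequality
    [||F||_2^2 <= ||d_1 F||_1 ||d_2 F||_1] to [F := V^(1/2) f^(n+1)]: since
    [|grad V| <= C V^(3/2)], the derivatives of [F] are controlled by
    [V |f|^(n+1) + V^(1/2) |f|^n |grad f|], hence by the density of [N] plus
    [V f^(2n)].  The moments pass to limits in the [V]-norm, and
    [|u|^(p+1) <= u^2 + u^(2n)] for [n] large. *)

(** * Integration tools and moments of approximated functions *)

Lemma integral_mul_fst_snd (d1 d2 : measure_display) (T1 : measurableType d1)
    (T2 : measurableType d2) (R : realType)
    (m1 : {sigma_finite_measure set T1 -> \bar R})
    (m2 : {sigma_finite_measure set T2 -> \bar R})
    (F : T1 -> \bar R) (G : T2 -> \bar R) :
  measurable_fun setT F -> measurable_fun setT G ->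
  (forall x, 0 <= F x)%E -> (forall y, 0 <= G y)%E ->
  (\int[m1 \x m2]_z (F z.1 * G z.2) = (\int[m1]_x F x) * (\int[m2]_y G y))%E.
Proof.
move=> mF mG F0 G0; rewrite fubini_tonelli1.
- rewrite /fubini_F /=; under eq_integral do rewrite ge0_integralZl//.
  by rewrite ge0_integralZr//; exact: integral_ge0.
- apply: emeasurable_funM.
    exact: (measurableT_comp mF measurable_fst).
  exact: (measurableT_comp mG measurable_snd).
- by move=> z; exact: mule_ge0.
Qed.

Lemma ge0_integral0_ae (d : measure_display) (T : measurableType d)
    (R : realType) (mu : {measure set T -> \bar R}) (f : T -> R) :
  (forall z, 0 <= f z) -> measurable_fun setT (EFin \o f) ->
  (\int[mu]_z (f z)%:E = 0)%E -> \forall z \ae mu, f z = 0.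
Proof.
move=> f0 mf If.
have : ae_eq mu setT (EFin \o f) (cst 0%E).
  apply/(ae_eq_integral_abs _ measurableT mf); rewrite -[RHS]If.
  by apply: eq_integral => z _; rewrite gee0_abs// lee_fin.
by apply: filterS => z /(_ Logic.I) /= [].
Qed.

(** If [u ^+ 2 <= 4 * f ^+ 2], take powers. Otherwise [f] is at distance at least [|u| / 2] from
    [u]: one factor [u ^+ 2] is paid for by [4 * (f - u) ^+ 2], and the other [n] factors by powers
    of [M ^+ 2]. *)
Lemma exprM2_le_near (R : realType) (u f M : R) (n : nat) : `|u| <= M ->
  u ^+ (2 * n.+1) <= 4 ^+ n.+1 * f ^+ (2 * n.+1) + 4 * M ^+ (2 * n) * (f - u) ^+ 2.
Proof.
move=> uM; rewrite !exprM -exprMn.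
have M0 : 0 <= M by rewrite (le_trans (normr_ge0 u)).
have [h|h] := leP (u ^+ 2) (4 * f ^+ 2).
  rewrite (le_trans (y := (4 * f ^+ 2) ^+ n.+1))//.
    by apply: lerXn2r => //; rewrite nnegrE ?sqr_ge0// mulr_ge0 ?sqr_ge0.
  rewrite lerDl mulr_ge0 ?sqr_ge0// mulr_ge0//.
  by apply: exprn_ge0; exact: sqr_ge0.
rewrite (le_trans (y := 4 * (M ^+ 2) ^+ n * (f - u) ^+ 2))//; last first.
  by rewrite lerDr exprn_ge0// mulr_ge0 ?sqr_ge0//.
rewrite exprSr (mulrC 4) -mulrA; apply: ler_pM.
- by apply: exprn_ge0; exact: sqr_ge0.
- exact: sqr_ge0.
- rewrite lerXn2r// ?nnegrE ?sqr_ge0//.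
  by rewrite -[u ^+ 2]real_normK ?num_real// lerXn2r// ?nnegrE.
(* Here [4 (f - u)^2 - u^2 = 2 (u - 2 f)^2 + (u^2 - 4 f^2)], and both terms are nonnegative in this
   case. *)
- have := sqr_ge0 (u - 2 * f); nra.
Qed.

(* Where [|u| <= M], either [u^2 <= 4 f^2] or [u^2 <= 4 (f - u)^2]; this bounds
   the moment of [u] on [{|u| <= M}] and replaces the extraction of an almost
   everywhere convergent subsequence. *)
Lemma moment_le_of_approx (d : measure_display) (T : measurableType d)
    (R : realType) (mu : {measure set T -> \bar R}) (V u : T -> R)
    (n : nat) (B : R) :
  (forall z, 0 <= V z) -> measurable_fun setT V -> measurable_fun setT u ->
  (forall e : R, 0 < e -> exists f : T -> R, [/\ measurable_fun setT f,
     (\int[mu]_z (V z * f z ^+ (2 * n.+1))%:E <= B%:E)%E &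
     (\int[mu]_z (V z * (f z - u z) ^+ 2)%:E <= e%:E)%E]) ->
  (\int[mu]_z (V z * u z ^+ (2 * n.+1))%:E <= (4 ^+ n.+1 * B)%:E)%E.
Proof.
move=> V0 mV mu_ approx.
have mX (g : T -> R) m : measurable_fun setT g ->
    measurable_fun setT (fun z => (V z * g z ^+ m)%:E).
  by move=> mg; apply/measurable_EFinP; apply: measurable_funM => //; exact: measurable_funX.
have X0 (g : T -> R) m z : (0 <= (V z * g z ^+ (2 * m))%:E)%E.
  by rewrite lee_fin mulr_ge0// exprM exprn_ge0// sqr_ge0.
(* The sets [F i] exhaust [T], so by monotone convergence a bound on each [F i] that is uniform in
   [i] is enough. *)
pose F (i : nat) : set T := [set z | `|u z| <= i%:R].
have mF i : measurable (F i).
  rewrite -[F i]setTI; apply: measurable_fun_le => //.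
  exact: measurableT_comp.
have homoF : {homo F : n m / (n <= m)%N >-> (n <= m)%O}.
  move=> i j ij; apply/subsetPset => z /= /le_trans; apply.
  by rewrite ler_nat.
have FT : \bigcup_i F i = setT.
  rewrite -subTset => z _.
  by exists (Num.bound `|u z|) => //=; exact/ltW/archi_boundP.
have cvgF := ge0_nondecreasing_set_cvg_integral (mu := mu) homoF mF
  (fun i => measurable_funTS (mX u (2 * n.+1)%N mu_)) (fun i z _ => X0 u n.+1 z).
rewrite FT in cvgF; rewrite -(cvg_lim _ cvgF)//.
apply: lime_le; first by apply/cvg_ex; eexists; exact: cvgF.
apply: nearW => i; apply/lee_addgt0Pr => e e0.
(* This factor of the error term grows with [i], which is harmless because [f] is chosen after [i].
   The tolerance is divided by [c + 1], since [c] itself may vanish. *)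
pose c : R := 4 * i%:R ^+ (2 * n).
have c0 : 0 <= c by rewrite mulr_ge0 ?exprn_ge0.
have c1 : 0 < c + 1 by rewrite ltr_wpDl.
have [f [mf fB fe]] := approx (e / (c + 1)) (divr_gt0 e0 c1).
have m2 : measurable_fun setT (fun z => (V z * (f z - u z) ^+ 2)%:E).
  by apply: (mX (fun z => f z - u z)); exact: measurable_funB.
have p2 z : (0 <= (V z * (f z - u z) ^+ 2)%:E)%E by rewrite lee_fin mulr_ge0 ?sqr_ge0.
pose S z := ((4 ^+ n.+1)%:E * (V z * f z ^+ (2 * n.+1))%:E
  + c%:E * (V z * (f z - u z) ^+ 2)%:E)%E.
have hmaj : (\int[mu]_(z in F i) (V z * u z ^+ (2 * n.+1))%:E <=
    \int[mu]_z S z)%E.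
  have mS : measurable_fun setT S.
    by apply: emeasurable_funD; apply: measurable_funeM => //; exact: mX.
  have pS z : (0 <= S z)%E.
    by rewrite adde_ge0 ?mule_ge0// lee_fin.
  apply: (@le_trans _ _ (\int[mu]_(z in F i) S z)%E).
    apply: ge0_le_integral => //.
    - exact: measurable_funTS (mX _ _ _).
    - exact: measurable_funTS.
    - move=> z zF; rewrite /S -!EFinM -EFinD lee_fin.
      rewrite [X in _ <= _ + X]mulrCA [X in _ <= X + _]mulrCA -mulrDr ler_wpM2l//.
      exact: exprM2_le_near.
  exact: ge0_subset_integral.
apply: (le_trans hmaj); rewrite /S ge0_integralD//; last 4 first.
- by move=> z _; rewrite mule_ge0.
- by apply: measurable_funeM; exact: mX.
- by move=> z _; rewrite mule_ge0.
- exact: measurable_funeM.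
rewrite !ge0_integralZl//; last exact: mX.
rewrite (EFinM (4 ^+ n.+1) B); apply: leeD; first by rewrite lee_wpmul2l// lee_fin.
apply: (@le_trans _ _ (c%:E * (e / (c + 1))%:E)%E); first by rewrite lee_wpmul2l.
rewrite -EFinM lee_fin mulrA ler_pdivrMr// mulrC ler_wpM2l// ?ltW//.
by rewrite ltrDl.
Qed.

(** * Measurability and supports of functions on the plane *)

Section Plane.
Variable R : realType.
Implicit Type f : R * R -> R.

(** An open set is the union of the rational open boxes that it contains. The union runs over all
    rational boxes, those not contained in [U] being replaced by the empty set, so that the index
    type is countable. *)
Lemma open_measurable_prod (U : set (R * R)) : open U -> measurable U.
Proof.
move=> oU.
pose B (i : (rat * rat) * (rat * rat)) : set (R * R) :=
  `](ratr i.1.1), (ratr i.1.2)[%classic `*` `](ratr i.2.1), (ratr i.2.2)[%classic.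
pose F i := if `[< B i `<=` U >] then B i else set0.
have -> : U = \bigcup_i F i.
  apply/seteqP; split => [[x y] Uxy|z [i _]]; last first.
    by rewrite /F; case: asboolP => // h /h.
  have := oU; rewrite openE => /(_ _ Uxy).
  move=> [[P Q] /= [/nbhs_ballP[_/posnumP[e] eP] /nbhs_ballP[_/posnumP[d] dQ]] PQ].
  have [|a] := @rat_in_itvoo R (x - e%:num) x; first by rewrite ltrBlDr ltrDl.
    rewrite in_itv /= => /andP[ha1 ha2].
  have [|b] := @rat_in_itvoo R x (x + e%:num); first by rewrite ltrDl.
    rewrite in_itv /= => /andP[hb1 hb2].
  have [|a'] := @rat_in_itvoo R (y - d%:num) y; first by rewrite ltrBlDr ltrDl.
    rewrite in_itv /= => /andP[hc1 hc2].
  have [|b'] := @rat_in_itvoo R y (y + d%:num); first by rewrite ltrDl.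
    rewrite in_itv /= => /andP[hd1 hd2].
  exists ((a, b), (a', b')) => //; rewrite /F; case: asboolP => [_|]; last first.
    case; rewrite /B /= => -[s t] [] /=; rewrite !in_itv /= => /andP[h1 h2] /andP[h3 h4].
    apply: PQ; split => /=; [apply: eP|apply: dQ]; rewrite /ball /= ltr_distlC.
      by rewrite (lt_trans ha1 h1) (lt_trans h2 hb2).
    by rewrite (lt_trans hc1 h3) (lt_trans h4 hd2).
  by split; rewrite /= in_itv /= ?ha2 ?hc2.
apply: countable_bigcupT_measurable => // i; rewrite /F; case: asboolP => // _.
by apply: measurableX; exact: measurable_itv.
Qed.

Lemma continuous_measurable_fun_prod f : continuous f -> measurable_fun setT f.
Proof.
move=> /continuousP cf; apply: (measurability _ (RGenOpens.measurableE R)).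
move=> _ [_ [a [b ->] <-]]; rewrite setTI; apply: open_measurable_prod.
exact/cf/interval_open.
Qed.

Lemma C1_continuous_dpart f b : C1 f -> continuous (dpart b f).
Proof. by move=> [_ /(_ b) []]. Qed.

Lemma C1_measurable f : C1 f -> measurable_fun setT f.
Proof. by case=> cf _; exact: continuous_measurable_fun_prod. Qed.

Lemma C1_measurable_dpart f b : C1 f -> measurable_fun setT (dpart b f).
Proof.
by move=> C1f; apply: continuous_measurable_fun_prod; exact: C1_continuous_dpart.
Qed.

Lemma Cc_infty_C1 f : Cc_infty f -> C1 f.
Proof.
move=> [sf _]; split; first by have [] := sf [::].
move=> b; split; first by have [_ /(_ b)] := sf [::].
by have [] := sf [:: b].
Qed.

Lemma Cc_infty_box f : Cc_infty f ->
  exists2 r : R, 0 < r & forall x y, f (x, y) != 0 -> `|x| < r /\ `|y| < r.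
Proof.
move=> [_ /compact_bounded [M [_ bM]]].
exists (`|M| + 1) => [|x y fxy0]; first by rewrite ltr_wpDl.
(* Boundedness gives only a large inequality for each bound above [M]; taking one strictly below [r]
   makes the final inequalities strict. *)
pose M' := (`|M| + (1 / 2)).
have /bM : M < M' by rewrite (le_lt_trans (ler_norm _))// ltrDl.
move=> /(_ (x, y)) /=; rewrite /M'.
have : closure (f @^-1` [set~ 0]) (x, y) by apply: subset_closure => /=; exact/eqP.
move=> h /(_ h); rewrite prod_normE /= ge_max => /andP[h1 h2]; split; lra.
Qed.

Lemma continuous_slice (b : bool) f (c : R) : continuous f ->
  continuous (fun t => f (if b then (t, c) else (c, t))).
Proof.
move=> cf t.
apply: (@continuous_comp _ _ _ (fun t => if b then (t, c) else (c, t)) f);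
  last exact: cf.
case: b.
  exact: (cvg_pair (@cvg_id _ (nbhs t)) (@cvg_cst _ c _ (nbhs t) _)).
exact: (cvg_pair (@cvg_cst _ c _ (nbhs t) _) (@cvg_id _ (nbhs t))).
Qed.

(** * The Gagliardo-Nirenberg inequality *)

(** This is the fundamental theorem of calculus on [[a, x]], with [a] so far to the left that
    [g a = 0]. *)
Lemma norm_le_integral_derive1 (g : R -> R) (r : R) :
  (forall x, derivable g x 1) -> continuous (derive1 g) ->
  (forall x, r <= `|x| -> g x = 0) ->
  forall x, (`|g x|%:E <= \int[lebesgue_measure]_s (`|derive1 g s|%:E))%E.
Proof.
move=> dg cg g0 x.
pose a := - (`|r| + `|x| + 1).
have ax : a < x.
  by rewrite /a ltrNl (le_lt_trans (ler_norm _))// normrN; have := normr_ge0 r; lra.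
have ga : g a = 0.
  apply: g0; rewrite /a normrN ger0_norm.
    by have := ler_norm r; have := normr_ge0 x; lra.
  by have := normr_ge0 x; have := normr_ge0 r; lra.
have mg : measurable_fun setT (derive1 g) by exact: continuous_measurable_fun.
have cgg : continuous g.
  by move=> y; apply: differentiable_continuous; apply/derivable1_diffP; exact: dg.
rewrite -abse_EFin.
have <- : (\int[lebesgue_measure]_(s in `[a, x]) (derive1 g s)%:E = (g x)%:E)%E.
  rewrite (@continuous_FTC2 _ (derive1 g) g a x ax).
  - by rewrite ga sube0.
  - exact: continuous_subspaceT.
  - split => //.
      exact: (cvg_at_right_filter (cgg a)).
    exact: (cvg_at_left_filter (cgg x)).
  - by [].
have mag (A : set R) : measurable_fun A (fun s => (`|derive1 g s|)%:E).
  apply/measurable_EFinP; apply: measurableT_comp => //.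
  exact: measurable_funTS.
rewrite (le_trans (le_abse_integral _ _ _))//.
  by apply/measurable_EFinP; exact: measurable_funTS.
by apply: ge0_subset_integral => //; exact: mag.
Qed.

(** The value [|f (x, y)|] is at most the integral of [|d_1 f|] along the horizontal line, a
    function of [y] alone, and at most that of [|d_2 f|] along the vertical line, a function of [x]
    alone. Multiplying the two bounds separates the variables, and the double integral factors by
    Tonelli. *)
Lemma gagliardo_nirenberg f (r : R) : C1 f ->
  (forall x y, f (x, y) != 0 -> `|x| < r /\ `|y| < r) ->
  (\int[@leb2 R]_z (f z ^+ 2)%:E <=
   (\int[@leb2 R]_z (`|dpart true f z|)%:E) *
   (\int[@leb2 R]_z (`|dpart false f z|)%:E))%E.
Proof.
move=> C1f supp.
have cd b : continuous (dpart b f) by exact: C1_continuous_dpart.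
have [cf df] := C1f.
have md b : measurable_fun setT (fun z => (`|dpart b f z|)%:E).
  apply/measurable_EFinP; apply: measurableT_comp => //.
  exact: continuous_measurable_fun_prod.
pose mu := @lebesgue_measure R.
pose F1 (y : R) := (\int[mu]_x (`|dpart true f (x, y)|)%:E)%E.
pose F2 (x : R) := (\int[mu]_y (`|dpart false f (x, y)|)%:E)%E.
have F10 y : (0 <= F1 y)%E by exact: integral_ge0.
have F20 x : (0 <= F2 x)%E by exact: integral_ge0.
have mF1 : measurable_fun setT F1.
  by apply: (@measurable_fun_fubini_tonelli_G _ _ _ _ _ mu _ (md true)).
have mF2 : measurable_fun setT F2.
  by apply: (@measurable_fun_fubini_tonelli_F _ _ _ _ _ mu _ (md false)).
have fF1 x y : ((`|f (x, y)|)%:E <= F1 y)%E.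
  apply: (@norm_le_integral_derive1 (fun t => f (t, y)) r).
  - by move=> t; have [/(_ (t, y))] := df true.
  - by apply: (@continuous_slice true _ y (cd true)).
  - move=> t rt; apply/eqP/negP => /negP /supp []; lra.
have fF2 x y : ((`|f (x, y)|)%:E <= F2 x)%E.
  apply: (@norm_le_integral_derive1 (fun t => f (x, t)) r).
  - by move=> t; have [/(_ (x, t))] := df false.
  - by apply: (@continuous_slice false _ x (cd false)).
  - move=> t rt; apply/eqP/negP => /negP /supp []; lra.
have IF1 : (\int[@leb2 R]_z (`|dpart true f z|)%:E = \int[mu]_y F1 y)%E.
  exact: (fubini_tonelli2 (m1 := mu) (m2 := mu) _ (md true) (fun=> normr_ge0 _)).
have IF2 : (\int[@leb2 R]_z (`|dpart false f z|)%:E = \int[mu]_x F2 x)%E.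
  exact: (fubini_tonelli1 (m1 := mu) (m2 := mu) _ (md false) (fun=> normr_ge0 _)).
rewrite {}IF1 {}IF2; clearbody F1 F2.
have mF : measurable_fun setT (fun z : R * R => (F2 z.1 * F1 z.2)%E).
  apply: emeasurable_funM.
    exact: (measurableT_comp mF2 measurable_fst).
  exact: (measurableT_comp mF1 measurable_snd).
apply: (@le_trans _ _ (\int[@leb2 R]_z (F2 z.1 * F1 z.2))%E).
  apply: ge0_le_integral => //.
  - by move=> z _; rewrite lee_fin sqr_ge0.
  - apply/measurable_EFinP; apply: measurable_funX.
    exact: continuous_measurable_fun_prod.
  - move=> [x y] _ /=; rewrite -real_normK ?num_real// expr2 EFinM.
    by apply: lee_pmul.
by rewrite /leb2 (@integral_mul_fst_snd _ _ _ _ _ mu mu F2 F1 mF2 mF1 F20 F10) muleC.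
Qed.

(** * Derivatives of [V^(1/2) f^(n+1)] and their pointwise bounds *)

Lemma is_derive_sqrtMX (v g : R -> R) (x dv dg : R) (n : nat) : 0 < v x ->
  is_derive x 1 v dv -> is_derive x 1 g dg ->
  is_derive x 1 (fun t => Num.sqrt (v t) * g t ^+ n.+1)
    ((2 * Num.sqrt (v x))^-1 * dv * g x ^+ n.+1
     + Num.sqrt (v x) * (n.+1%:R * g x ^+ n * dg)).
Proof.
move=> vx hv hg.
have h := is_deriveM (is_derive1_comp (is_derive1_sqrt vx) hv) (is_deriveX n.+1 hg).
have -> : (fun t => Num.sqrt (v t) * g t ^+ n.+1) = (Num.sqrt \o v) * (g ^+ n.+1).
  by apply/funext => t /=; rewrite fctE exprfctE.
apply: is_derive_eq h _.
rewrite exprfctE /= /GRing.scale /=; ring.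
Qed.

Lemma C1_sqrtMX (V f : R * R -> R) (n : nat) : (forall z, 0 < V z) ->
  C1 V -> C1 f ->
  let F z := Num.sqrt (V z) * f z ^+ n.+1 in
  C1 F /\ forall b z, dpart b F z =
    (2 * Num.sqrt (V z))^-1 * dpart b V z * f z ^+ n.+1
     + Num.sqrt (V z) * (n.+1%:R * f z ^+ n * dpart b f z).
Proof.
move=> V0 [cV dV] [cf df] F.
have hF b z : pderivable b F z /\ dpart b F z =
    (2 * Num.sqrt (V z))^-1 * dpart b V z * f z ^+ n.+1
     + Num.sqrt (V z) * (n.+1%:R * f z ^+ n * dpart b f z).
  have [/(_ z) hV _] := dV b; have [/(_ z) hf _] := df b.
  case: z b hV hf => x y [] hV hf; rewrite /pderivable /dpart /=.
  - have hV' := derivableP hV; have hf' := derivableP hf.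
    have [h1 h2] := @is_derive_sqrtMX (fun t => V (t, y)) (fun t => f (t, y))
      x _ _ n (V0 (x, y)) hV' hf'.
    by split => //; rewrite !derive1E h2.
  - have hV' := derivableP hV; have hf' := derivableP hf.
    have [h1 h2] := @is_derive_sqrtMX (fun t => V (x, t)) (fun t => f (x, t))
      y _ _ n (V0 (x, y)) hV' hf'.
    by split => //; rewrite !derive1E h2.
have cs : continuous (fun z => Num.sqrt (V z)).
  by move=> z; exact: (continuous_comp (cV z) (@sqrt_continuous R (V z))).
have cX m : continuous (fun z => f z ^+ m).
  by move=> z; exact: (continuous_comp (cf z) (@exprn_continuous R m (f z))).
split; last by move=> b z; have [] := hF b z.
split; first by move=> z; apply: cvgM; [exact: cs|exact: cX].
move=> b; split; first by move=> z; have [] := hF b z.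
have -> : dpart b F = fun z => (2 * Num.sqrt (V z))^-1 * dpart b V z * f z ^+ n.+1
     + Num.sqrt (V z) * (n.+1%:R * f z ^+ n * dpart b f z).
  by apply/funext => z; have [] := hF b z.
have [_ cdV] := dV b; have [_ cdf] := df b.
move=> z; apply: cvgD.
  apply: cvgM; last exact: cX.
  apply: cvgM; last exact: cdV.
  apply: cvgV.
    by rewrite mulf_neq0// gt_eqF// sqrtr_gt0.
  by apply: cvgM; [exact: cvg_cst|exact: cs].
apply: cvgM; first exact: cs.
apply: cvgM; last exact: cdf.
by apply: cvgM; [exact: cvg_cst|exact: cX].
Qed.

(** For [n = 1] all three exponents are [2]; for larger [n], [n + 1] lies between [2] and [2n].
    Compare with the first power when [a <= 1], with the second otherwise. *)
Lemma exprS_le_sqrD_exprM2 (a : R) (n : nat) : 0 <= a -> (0 < n)%N ->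
  a ^+ n.+1 <= a ^+ 2 + a ^+ (2 * n).
Proof.
move=> a0 n0; have [a1|a1] := leP a 1.
  rewrite (le_trans (y := a ^+ 2))// ?lerDl ?exprn_ge0//.
  by rewrite ler_wiXn2l// ltnS.
rewrite (le_trans (y := a ^+ (2 * n)))// ?lerDr ?exprn_ge0//.
rewrite ler_weXn2l// ?ltW//; last by rewrite mul2n -addnn -addn1 leq_add2l.
Qed.

(** Here [s] stands for [V^(1/2)], [dv] for a partial derivative of [V], and the hypothesis on [dv]
    for [|grad V| <= C V^(3/2)]. The first term is at most [C s^2 |g|^(n+1)], which is then
    interpolated between the powers [2] and [2n]; the second is split by the inequality of
    arithmetic and geometric means. *)
Lemma norm_dsqrtMX_le (C s dv g dg : R) (n : nat) : 0 < s -> 0 < C ->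
  (0 < n)%N -> `|dv| <= C * s ^+ 3 ->
  `|(2 * s)^-1 * dv * g ^+ n.+1 + s * (n.+1%:R * g ^+ n * dg)| <=
  (C + n.+1%:R) * (dg ^+ 2 + s ^+ 2 * g ^+ 2 + s ^+ 2 * g ^+ (2 * n)).
Proof.
move=> s0 C0 n0 hdv.
have e2n : g ^+ (2 * n) = `|g| ^+ (2 * n).
  by rewrite -normrX ger0_norm// exprM exprn_ge0// sqr_ge0.
have e2 : g ^+ 2 = `|g| ^+ 2 by rewrite -normrX ger0_norm// sqr_ge0.
have ed : dg ^+ 2 = `|dg| ^+ 2 by rewrite -normrX ger0_norm// sqr_ge0.
have h1 : `|(2 * s)^-1 * dv * g ^+ n.+1| <= C * (s ^+ 2 * `|g| ^+ n.+1).
  rewrite !normrM normrX gtr0_norm ?invr_gt0 ?mulr_gt0//.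
  rewrite mulrA ler_wpM2r ?exprn_ge0//.
  rewrite mulrC ler_pdivrMr ?mulr_gt0// (le_trans hdv)//.
  have := mulr_gt0 C0 (exprn_gt0 3 s0).
  have -> : C * s ^+ 2 * (2 * s) = 2 * (C * s ^+ 3) by ring.
  lra.
have h2 : `|s * (n.+1%:R * g ^+ n * dg)| <=
    n.+1%:R * (dg ^+ 2 + s ^+ 2 * g ^+ (2 * n)).
  rewrite !normrM (gtr0_norm s0) normr_nat normrX.
  rewrite -(mulrA n.+1%:R) (mulrCA s) ler_wpM2l// ed e2n mulnC exprM.
  set G := `|g| ^+ n; set D := `|dg|.
  have : 0 <= G by exact: exprn_ge0.
  have : 0 <= D by exact: normr_ge0.
  have : 0 <= (s * G - D) ^+ 2 by exact: sqr_ge0.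
  move=> h0 hD hG; have : 0 <= s * G * D by rewrite !mulr_ge0// ltW.
  by move: h0; rewrite sqrrB exprMn; lra.
have h3 := exprS_le_sqrD_exprM2 (normr_ge0 g) n0.
rewrite (le_trans (ler_normD _ _))// (le_trans (lerD h1 h2))//.
have h4 : C * (s ^+ 2 * `|g| ^+ n.+1) <= C * (s ^+ 2 * (g ^+ 2 + g ^+ (2 * n))).
  by rewrite ler_pM2l// ler_pM2l ?exprn_gt0// e2 e2n.
apply: (le_trans (lerD h4 (lexx _))).
have : 0 <= C * dg ^+ 2 by rewrite mulr_ge0 ?sqr_ge0// ltW.
have : 0 <= n.+1%:R * (s ^+ 2 * g ^+ 2).
  by apply: mulr_ge0 => //; apply: mulr_ge0; exact: sqr_ge0.
lra.
Qed.

Lemma powR3half (v : R) : 0 < v -> v `^ (3 / 2) = Num.sqrt v ^+ 3.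
Proof.
move=> v0; rewrite (_ : 3 / 2 = 2^-1 * 3%:R); last by rewrite mulrC.
by rewrite powRrM powR_mulrn ?powR_ge0// powR12_sqrt// ltW.
Qed.

(** * Even moments of test functions *)

Lemma measurable_normV2 (V u g1 g2 : R * R -> R) : measurable_fun setT V ->
  measurable_fun setT u -> measurable_fun setT g1 -> measurable_fun setT g2 ->
  measurable_fun setT (fun z => (g1 z ^+ 2 + g2 z ^+ 2 + V z * u z ^+ 2)%:E).
Proof.
move=> mV mu mg1 mg2; apply/measurable_EFinP.
apply: measurable_funD; last by apply: measurable_funM => //; exact: measurable_funX.
by apply: measurable_funD; exact: measurable_funX.
Qed.

(** The constant is uniform in [f], which later allows passing to the limit. Gagliardo-Nirenberg
    yields a bound quadratic in the squared norm; the restriction to squared norm at most [1] turns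
    it back into a linear one, so the induction closes. *)
Lemma even_moment_bound (V : R * R -> R) (C : R) : C1 V ->
  (forall z, 0 < V z) -> 0 < C ->
  (\forall z \ae @leb2 R,
     Num.sqrt (dpart true V z ^+ 2 + dpart false V z ^+ 2)
       <= C * powR (V z) (3 / 2)) ->
  forall n, exists2 K : R, 0 <= K & forall f, Cc_infty f ->
    (normV2 V f (dpart true f) (dpart false f) <= 1)%E ->
    (\int[@leb2 R]_z (V z * f z ^+ (2 * n.+1))%:E <=
      K%:E * normV2 V f (dpart true f) (dpart false f))%E.
Proof.
move=> C1V V0 C0 aeV.
have mV := C1_measurable C1V.
elim=> [|n [K K0 IH]].
  exists 1 => // f Cf _; rewrite mul1e /normV2.
  have C1f := Cc_infty_C1 Cf.
  have mf := C1_measurable C1f.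
  have mdf b := C1_measurable_dpart b C1f.
  apply: ge0_le_integral => //.
  - by move=> z _; rewrite lee_fin mulr_ge0 ?sqr_ge0// ltW.
  - by apply/measurable_EFinP; apply: measurable_funM => //; exact: measurable_funX.
  - exact: measurable_normV2.
  - by move=> z _; rewrite lee_fin muln1 lerDr addr_ge0 ?sqr_ge0.
(* [M] is the constant of [norm_dsqrtMX_le] for the power [n.+2]. Each partial derivative then has
   [L^1] norm at most [M (N + K N)], where [K N] bounds the previous moment; the product of the two
   bounds gives the square below. *)
pose M := C + n.+2%:R; have M0 : 0 <= M by rewrite addr_ge0// ltW.
exists ((M * (1 + K)) ^+ 2); first exact: sqr_ge0.
move=> f Cf N1; have IHf := IH f Cf N1.
have C1f := Cc_infty_C1 Cf.
have [r r0 supp] := Cc_infty_box Cf.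
have [C1F dF] := C1_sqrtMX n.+1 V0 C1V C1f.
have mf := C1_measurable C1f.
have mdf b := C1_measurable_dpart b C1f.
have mN := measurable_normV2 mV mf (mdf true) (mdf false).
have mA : measurable_fun setT (fun z => (V z * f z ^+ (2 * n.+1))%:E).
  by apply/measurable_EFinP; apply: measurable_funM => //; exact: measurable_funX.
have A0 z : (0 <= (V z * f z ^+ (2 * n.+1))%:E)%E.
  rewrite lee_fin; apply: mulr_ge0; first exact: ltW.
  by rewrite exprM exprn_ge0// sqr_ge0.
have N0 z : (0 <= (dpart true f z ^+ 2 + dpart false f z ^+ 2 + V z * f z ^+ 2)%:E)%E.
  by rewrite lee_fin !addr_ge0 ?sqr_ge0// mulr_ge0 ?sqr_ge0// ltW.
have dF_le b : (\int[@leb2 R]_z (`|dpart b (fun z => Num.sqrt (V z) * f z ^+ n.+2) z|)%:E <=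
    M%:E * (normV2 V f (dpart true f) (dpart false f) +
            \int[@leb2 R]_z (V z * f z ^+ (2 * n.+1))%:E))%E.
  rewrite /normV2 -ge0_integralD// -ge0_integralZl//; last 2 first.
    exact: emeasurable_funD.
    by move=> z _; exact: adde_ge0.
  apply: ae_ge0_le_integral => //.
  - apply/measurable_EFinP; apply: measurableT_comp => //.
    by apply: continuous_measurable_fun_prod; exact: C1_continuous_dpart.
  - by move=> z _; rewrite mule_ge0// adde_ge0.
  - by apply: measurable_funeM; exact: emeasurable_funD.
  (* The exceptional set of the gradient hypothesis serves both partial derivatives, each being
     dominated by the Euclidean norm of the gradient. *)
  - case: aeV => A [mAA A0' sA]; exists A; split => // z /= nz; apply: sA => /= hz.
    apply: nz => _.
    rewrite dF -EFinD -EFinM lee_fin.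
    have s0 : 0 < Num.sqrt (V z) by rewrite sqrtr_gt0.
    have hb : `|dpart b V z| <= C * Num.sqrt (V z) ^+ 3.
      rewrite -powR3half// (le_trans _ hz)// -sqrtr_sqr ler_wsqrtr//.
      by case: (b); rewrite ?lerDl ?lerDr sqr_ge0.
    apply: (le_trans (norm_dsqrtMX_le _ _ s0 C0 _ hb)) => //.
    rewrite (sqr_sqrtr (ltW (V0 z))) -/M ler_wpM2l// lerD2r lerD2r.
    by case: (b); rewrite ?lerDl ?lerDr sqr_ge0.
have -> : (\int[@leb2 R]_z (V z * f z ^+ (2 * n.+2))%:E =
    \int[@leb2 R]_z ((Num.sqrt (V z) * f z ^+ n.+2) ^+ 2)%:E)%E.
  apply: eq_integral => z _; rewrite exprMn sqr_sqrtr ?ltW//.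
  by rewrite -exprM mulnC.
have suppF x y : Num.sqrt (V (x, y)) * f (x, y) ^+ n.+2 != 0 -> `|x| < r /\ `|y| < r.
  rewrite mulf_eq0 negb_or => /andP[_ h]; apply: supp; apply: contra h => /eqP ->.
  by rewrite expr0n.
apply: (le_trans (gagliardo_nirenberg C1F suppF)).
set I1 := (X in (X * _ <= _)%E); set I2 := (X in (_ * X <= _)%E).
have I1_le := dF_le true; have I2_le := dF_le false; rewrite -/I1 -/I2 in I1_le I2_le.
have : (0 <= normV2 V f (dpart true f) (dpart false f))%E by exact: integral_ge0.
have : (0 <= \int[@leb2 R]_z (V z * f z ^+ (2 * n.+1))%:E)%E by exact: integral_ge0.
have I10 : (0 <= I1)%E by exact: integral_ge0.
have I20 : (0 <= I2)%E by exact: integral_ge0.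
move: IHf N1 I1_le I2_le I10 I20; clearbody I1 I2.
move: (normV2 _ _ _ _) (integral _ _ _) => N A AKN N1 I1_le I2_le I10 I20 A_ge0 N_ge0.
have I_le I : (I <= M%:E * (N + A) -> I <= (M * (1 + K))%:E * N)%E.
  move=> /le_trans; apply; rewrite EFinM -muleA lee_wpmul2l// EFinD.
  by rewrite ge0_muleDl// mul1e leeD2l.
apply: (le_trans (lee_pmul I10 I20 (I_le _ I1_le) (I_le _ I2_le))).
rewrite muleACA -EFinM -expr2 lee_wpmul2l// ?lee_fin ?sqr_ge0//.
(* This is [N * N <= N], from [N <= 1]. *)
by rewrite -[leRHS]mule1 lee_wpmul2l.
Qed.

(** * Finite norm of test functions and a positive lower bound for the potential *)

(** At a point outside the closed box, [f] vanishes near that point along the line of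
    differentiation, so its partial derivative there is that of a constant. The conclusion has large
    inequalities because the argument uses that the complement of the closed box is open. *)
Lemma dpart_support f (r : R) b x y :
  (forall x y, f (x, y) != 0 -> `|x| < r /\ `|y| < r) ->
  dpart b f (x, y) != 0 -> `|x| <= r /\ `|y| <= r.
Proof.
move=> supp.
have f0 s t : (r < `|s|) || (r < `|t|) -> f (s, t) = 0.
  move=> h; apply/eqP; apply: contraT => /supp [h1 h2].
  by move: h; rewrite !ltNge (ltW h1) (ltW h2).
have near_gt (a : R) : r < `|a| -> \forall t \near a, r < `|t|.
  by move=> ra; apply: (cvgr_gt _ (@norm_continuous _ R^o a)).
move=> h; suff : ~~ ((r < `|x|) || (r < `|y|)) by rewrite negb_or -!leNgt => /andP.
apply: contra h => /orP h; apply/eqP.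
case: b; rewrite /dpart derive1E /=.
- have E : \forall t \near x, f (t, y) = cst 0 t.
    case: h => h; last by apply: (@filterE _ (nbhs x)) => t; rewrite f0// h orbT.
    by apply: (@filterS _ (nbhs x) _ _ _ _ (near_gt _ h)) => t ht; rewrite f0// ht.
  by rewrite (near_eq_derive _ E) derive_cst.
- have E : \forall t \near y, f (x, t) = cst 0 t.
    case: h => h; first by apply: (@filterE _ (nbhs y)) => t; rewrite f0// h.
    by apply: (@filterS _ (nbhs y) _ _ _ _ (near_gt _ h)) => t ht; rewrite f0// ht orbT.
  by rewrite (near_eq_derive _ E) derive_cst.
Qed.

Lemma box_compact (r : R) : compact (`[- r, r] `*` `[- r, r] : set (R * R)).
Proof. by apply: compact_setX; exact: segment_compact. Qed.

(** The density is continuous and vanishes outside a compact box, hence is at most its maximum times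
    the indicator of a set of finite area. *)
Lemma normV2_Cc_infty_lty (V : R * R -> R) f : continuous V ->
  (forall z, 0 < V z) -> Cc_infty f ->
  (normV2 V f (dpart true f) (dpart false f) < +oo)%E.
Proof.
move=> cV V0 Cf; have C1f := Cc_infty_C1 Cf.
have [r r0 supp] := Cc_infty_box Cf.
have [cf _] := C1f.
have cd b : continuous (dpart b f) by exact: C1_continuous_dpart.
pose B : set (R * R) := `[- r, r] `*` `[- r, r].
pose G z := dpart true f z ^+ 2 + dpart false f z ^+ 2 + V z * f z ^+ 2.
have cG : continuous G.
  move=> z; apply: cvgD; first apply: cvgD.
  - by apply: (@cvgM _ _ _ _ (dpart true f) (dpart true f)); exact: cd.
  - by apply: (@cvgM _ _ _ _ (dpart false f) (dpart false f)); exact: cd.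
  - apply: cvgM; first exact: cV.
    by apply: (@cvgM _ _ _ _ f f); exact: cf.
have G0 z : 0 <= G z by rewrite /G !addr_ge0 ?sqr_ge0// mulr_ge0 ?sqr_ge0// ltW.
have [|c _ Gc] := @compact_EVT_max _ R G B _ (@box_compact r) (continuous_subspaceT cG).
  by exists (0, 0); split; rewrite /= in_itv /= oppr_le0 ltW.
have mB : measurable B by apply: measurableX; exact: measurable_itv.
have GB z : G z <= G c * \1_B z.
  rewrite indicE; case: (boolP (z \in B)) => zB; first by rewrite mulr1; exact: Gc.
  rewrite mulr0 /G; case: z zB => x y zB.
  have notB (a : R) : (a != 0 -> `|x| <= r /\ `|y| <= r) -> a = 0.
    move=> h; apply/eqP; apply: contraNT zB => /h [hx hy].
    by rewrite inE; split; rewrite /= in_itv /= -ler_norml.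
  rewrite !(notB (dpart _ f (x, y)) (dpart_support supp)).
  rewrite (notB (f (x, y))) ?expr0n ?mulr0 ?addr0//.
  by move=> /supp [/ltW ? /ltW ?].
apply: (@le_lt_trans _ _ (\int[@leb2 R]_z ((G c)%:E * (\1_B z)%:E))%E).
  apply: ge0_le_integral => //.
  - by move=> z _; rewrite lee_fin; exact: G0.
  - apply: (@measurable_normV2 V f (dpart true f) (dpart false f));
      exact: continuous_measurable_fun_prod.
  - by apply: measurable_funeM; apply/measurable_EFinP.
  - by move=> z _; rewrite -EFinM lee_fin; exact: GB.
rewrite ge0_integralZl//; last 2 first.
- by apply/measurable_EFinP; exact: measurable_indic.
- by rewrite lee_fin; exact: G0.
rewrite integral_indic// setIT.
rewrite [X in (_ * X)%E](_ : _ = (r - - r)%:E * (r - - r)%:E)%E; last first.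
  pose J := [set` `[- r, r]] : set (measurableTypeR R).
  transitivity (lebesgue_measure J * lebesgue_measure J)%E.
    by apply: product_measure1E; exact: measurable_itv.
  by rewrite /= lebesgue_measure_itv /= lte_fin gtrN// -EFinD.
by rewrite -!EFinM ltry.
Qed.

(** Coercivity gives [V > 1] outside a large square, and on the square the continuous positive [V]
    attains a positive minimum. *)
Lemma coercive_lower_bound (V : R * R -> R) : continuous V ->
  (forall z, 0 < V z) ->
  (forall M : R, exists r : R, forall z, r < euclid_norm z -> M < V z) ->
  exists2 c : R, 0 < c & forall z, c <= V z.
Proof.
move=> cV V0 /(_ 1) [r hr]; pose s := `|r| + 1.
have s0 : 0 < s by rewrite ltr_wpDl.
pose B : set (R * R) := `[- s, s] `*` `[- s, s].
have [|c _ hc] := @compact_EVT_min _ R V B _ (@box_compact s) (continuous_subspaceT cV).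
  by exists (0, 0); split; rewrite /= in_itv /= oppr_le0 ltW.
exists (Num.min (V c) 1); first by rewrite lt_min V0 ltr01.
move=> z; rewrite ge_min; case: (boolP (z \in B)) => zB; first by rewrite hc.
apply/orP; right; apply/ltW/hr.
have rs : r < s by rewrite (le_lt_trans (ler_norm r))// ltrDl.
case: z zB => x y zB.
have : ~~ ((`|x| <= s) && (`|y| <= s)).
  apply: contra zB => /andP[hx hy]; rewrite inE.
  by split; rewrite /= in_itv /= -ler_norml.
rewrite negb_and -!ltNge => /orP[h|h]; apply: (lt_trans rs); apply: (lt_le_trans h);
  by rewrite -sqrtr_sqr ler_wsqrtr //= ?lerDl ?lerDr sqr_ge0.
Qed.

(** * The squared norm on the completion *)

Lemma normV2_ge0 (V u g1 g2 : R * R -> R) : (forall z, 0 < V z) ->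
  (0 <= normV2 V u g1 g2)%E.
Proof.
move=> V0; apply: integral_ge0 => z _; rewrite lee_fin.
by rewrite !addr_ge0 ?sqr_ge0// mulr_ge0 ?sqr_ge0// ltW.
Qed.

Lemma normV2_subC (V u g1 g2 v h1 h2 : R * R -> R) :
  normV2 V (u \- v) (g1 \- h1) (g2 \- h2) = normV2 V (v \- u) (h1 \- g1) (h2 \- g2).
Proof.
apply: eq_integral => z _ /=; congr (_%:E); ring.
Qed.

(** This plays the part of the triangle inequality, stated for squared norms so that it can be used
    directly with extended real values. *)
Lemma normV2_le_double (V u g1 g2 v h1 h2 : R * R -> R) : (forall z, 0 < V z) ->
  measurable_fun setT V ->
  measurable_fun setT u -> measurable_fun setT g1 -> measurable_fun setT g2 ->
  measurable_fun setT v -> measurable_fun setT h1 -> measurable_fun setT h2 ->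
  (normV2 V u g1 g2 <= 2%:E * normV2 V v h1 h2 +
     2%:E * normV2 V (v \- u)%R (h1 \- g1)%R (h2 \- g2)%R)%E.
Proof.
move=> V0 mV mu mg1 mg2 mv mh1 mh2.
have p0 (a b c : R * R -> R) z : (0 <= (b z ^+ 2 + c z ^+ 2 + V z * a z ^+ 2)%:E)%E.
  by rewrite lee_fin !addr_ge0 ?sqr_ge0// mulr_ge0 ?sqr_ge0// ltW.
have m1 := measurable_normV2 mV mv mh1 mh2.
have m2 := measurable_normV2 mV (measurable_funB mv mu) (measurable_funB mh1 mg1)
  (measurable_funB mh2 mg2).
have p1 := p0 v h1 h2.
have p2 := p0 (v \- u) (h1 \- g1) (h2 \- g2).
rewrite /normV2 -!ge0_integralZl// -ge0_integralD//; last 4 first.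
- by move=> z _; rewrite mule_ge0.
- exact: measurable_funeM.
- by move=> z _; rewrite mule_ge0.
- exact: measurable_funeM.
apply: ge0_le_integral => //.
- exact: measurable_normV2.
- by apply: emeasurable_funD; exact: measurable_funeM.
- move=> z _; rewrite -!EFinM -EFinD lee_fin /=.
  have sq (a b : R) : a ^+ 2 <= 2 * b ^+ 2 + 2 * (b - a) ^+ 2.
    (* The difference of the two sides is exactly [(2 b - a)^2]. *)
    by have := sqr_ge0 (2 * b - a); nra.
  have := sq (g1 z) (h1 z); have := sq (g2 z) (h2 z).
  have := ler_wpM2l (ltW (V0 z)) (sq (u z) (v z)).
  set q1 := (h1 z - _) ^+ 2; set q2 := (h2 z - _) ^+ 2; set q3 := (v z - _) ^+ 2.
  lra.
Qed.

Lemma H1V_approx (V u g1 g2 : R * R -> R) (e : R) : H1V V u g1 g2 -> 0 < e ->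
  exists2 f, Cc_infty f &
    (normV2 V (f \- u)%R (dpart true f \- g1)%R (dpart false f \- g2)%R <= e%:E)%E.
Proof.
move=> [_ [_ [_ [phi [Cphi cvg]]]]] e0.
have e0' : (0 < e%:E)%E by rewrite lte_fin.
have [n _ /(_ n (leqnn n)) /= h] := cvg _ (open_ereal_lt' e0').
by exists (phi n) => //; exact: ltW.
Qed.

(** Compare [u] with a test function at squared distance at most [1], whose own norm is finite. *)
Lemma normV2_H1V_lty (V u g1 g2 : R * R -> R) : continuous V ->
  (forall z, 0 < V z) -> H1V V u g1 g2 -> (normV2 V u g1 g2 < +oo)%E.
Proof.
move=> cV V0 Hu; have [mu [mg1 [mg2 _]]] := Hu.
have [f Cf fu] := H1V_approx Hu ltr01.
have C1f := Cc_infty_C1 Cf.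
have mf := C1_measurable C1f.
have mdf b := C1_measurable_dpart b C1f.
have mV : measurable_fun setT V by exact: continuous_measurable_fun_prod.
apply: (le_lt_trans (normV2_le_double V0 mV mu mg1 mg2 mf (mdf true) (mdf false))).
apply: lte_add_pinfty; apply: lte_mul_pinfty => //.
  exact: normV2_Cc_infty_lty.
by rewrite (le_lt_trans fu)// ltry.
Qed.

Lemma Vmoment_le_normV2 (V u g1 g2 : R * R -> R) : (forall z, 0 < V z) ->
  measurable_fun setT V -> measurable_fun setT u ->
  measurable_fun setT g1 -> measurable_fun setT g2 ->
  (\int[@leb2 R]_z (V z * u z ^+ 2)%:E <= normV2 V u g1 g2)%E.
Proof.
move=> V0 mV mu mg1 mg2; apply: ge0_le_integral => //.
- by move=> z _; rewrite lee_fin mulr_ge0 ?sqr_ge0// ltW.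
- by apply/measurable_EFinP; apply: measurable_funM => //; exact: measurable_funX.
- exact: measurable_normV2.
- by move=> z _; rewrite lee_fin lerDr addr_ge0 ?sqr_ge0.
Qed.

(** * The weighted integral of [|u|^(p+1)] *)

Lemma powR_le_sqrD_exprM2 (a p : R) (n : nat) : 0 <= a -> 1 < p ->
  p + 1 <= (2 * n.+1)%:R -> a `^ (p + 1) <= a ^+ 2 + a ^+ (2 * n.+1).
Proof.
move=> a0 p1 pn; have [a1|a1] := leP a 1; last first.
  rewrite (le_trans (y := a ^+ (2 * n.+1)))// ?lerDr ?exprn_ge0//.
  by rewrite -powR_mulrn// ler_powR// ltW.
rewrite (le_trans (y := a ^+ 2))// ?lerDl ?exprn_ge0//.
move: a0; rewrite le_eqVlt => /orP[/eqP <-|a0].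
  by rewrite powR0 ?sqr_ge0// gt_eqF//; lra.
rewrite -(powR_mulrn 2 (ltW a0)) ger_powR ?a0//; lra.
Qed.

(** The threshold [1/4] ensures that approximants, whose squared norm is at most [4 N], satisfy the
    restriction in [even_moment_bound]. Positivity of [N] permits an approximation error of at most
    [N]. *)
Lemma Vpow_bound (V : R * R -> R) (p C : R) : 1 < p -> C1 V ->
  (forall z, 0 < V z) -> 0 < C ->
  (\forall z \ae @leb2 R,
     Num.sqrt (dpart true V z ^+ 2 + dpart false V z ^+ 2)
       <= C * powR (V z) (3 / 2)) ->
  exists2 K : R, 0 < K & forall u g1 g2, H1V V u g1 g2 ->
    (0 < normV2 V u g1 g2)%E -> (normV2 V u g1 g2 <= (4^-1)%:E)%E ->
    (Vpow V p u <= K%:E * normV2 V u g1 g2)%E.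
Proof.
move=> p1 C1V V0 C0 aeV.
have cV : continuous V by case: C1V.
have mV : measurable_fun setT V by exact: continuous_measurable_fun_prod.
pose n := Num.bound (p + 1).
have pn : p + 1 <= (2 * n.+1)%:R.
  have /ltW/le_trans : p + 1 < n%:R by apply: archi_boundP; lra.
  by apply; rewrite ler_nat mul2n -addnn -addSnnS leq_addl.
have [K K0 hK] := even_moment_bound C1V V0 C0 aeV n.
(* The [1] accounts for the integral of [V u^2], the power of [4] for the passage to the limit in
   [moment_le_of_approx], and the last [4] for the doubling estimate on the approximants. *)
exists (1 + 4 ^+ n.+1 * (K * 4)).
  by rewrite ltr_wpDr//; apply: mulr_ge0; [exact: exprn_ge0|exact: mulr_ge0].
move=> u g1 g2 Hu Npos Nle; have [mu [mg1 [mg2 _]]] := Hu.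
have Nfin : normV2 V u g1 g2 \is a fin_num.
  by rewrite ge0_fin_numE ?ltW// (le_lt_trans Nle)// ltry.
have NE := fineK Nfin; set N := fine _ in NE.
have N0 : 0 < N by rewrite -lte_fin NE.
have N4 : N <= 4^-1 by rewrite -lee_fin NE.
have mX m : measurable_fun setT (fun z => (V z * u z ^+ m)%:E).
  by apply/measurable_EFinP; apply: measurable_funM => //; exact: measurable_funX.
have X0 m z : (0 <= (V z * u z ^+ (2 * m))%:E)%E.
  by rewrite lee_fin mulr_ge0 ?(ltW (V0 z))// exprM exprn_ge0// sqr_ge0.
have hmom : (\int[@leb2 R]_z (V z * u z ^+ (2 * n.+1))%:E <=
    (4 ^+ n.+1 * (K * 4 * N))%:E)%E.
  apply: moment_le_of_approx => // [z|e e0]; first exact: ltW.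
  (* The error must be below [e] for the limit argument and below [N] to keep the norm of [f] under
     control. *)
  have eN : 0 < Num.min e N by rewrite lt_min e0.
  have [f Cf fu] := H1V_approx Hu eN.
  have C1f := Cc_infty_C1 Cf.
  have mf := C1_measurable C1f.
  have mdf b := C1_measurable_dpart b C1f.
  have fle : (normV2 V f (dpart true f) (dpart false f) <= (4 * N)%:E)%E.
    apply: (le_trans (normV2_le_double V0 mV mf (mdf true) (mdf false) mu mg1 mg2)).
    rewrite normV2_subC -NE.
    apply: (@le_trans _ _ (2%:E * N%:E + 2%:E * N%:E)%E); last first.
      by rewrite -!EFinM -EFinD lee_fin; lra.
    by rewrite leeD2l// lee_wpmul2l// (le_trans fu)// lee_fin ge_min lexx orbT.
  exists f; split => //.
  - apply: (le_trans (hK f Cf _)).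
      by rewrite (le_trans fle)// lee_fin; lra.
    by rewrite -mulrA (EFinM K) lee_wpmul2l.
  - apply: (le_trans (Vmoment_le_normV2 V0 mV (measurable_funB mf mu)
      (measurable_funB (mdf true) mg1) (measurable_funB (mdf false) mg2))).
    by rewrite (le_trans fu)// lee_fin ge_min lexx.
apply: (@le_trans _ _ (\int[@leb2 R]_z
    ((V z * u z ^+ 2)%:E + (V z * u z ^+ (2 * n.+1))%:E))%E).
  apply: ge0_le_integral => //.
  - by move=> z _; rewrite lee_fin mulr_ge0 ?powR_ge0// ltW.
  - apply/measurable_EFinP; apply: measurable_funM => //.
    apply: (measurableT_comp (measurable_powR _)).
    exact: measurableT_comp.
  - by apply: emeasurable_funD; exact: mX.
  - move=> z _; rewrite -EFinD lee_fin -mulrDr ler_wpM2l ?(ltW (V0 z))//.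
    have := powR_le_sqrD_exprM2 (normr_ge0 (u z)) p1 pn.
    have e m : `|u z| ^+ (2 * m) = u z ^+ (2 * m).
      by rewrite -normrX ger0_norm// exprM exprn_ge0// sqr_ge0.
    by rewrite e (e 1%N : `|u z| ^+ 2 = u z ^+ 2).
rewrite ge0_integralD; [|by []|by move=> z _; exact: (X0 1%N)|exact: mX|
  by move=> z _; exact: X0|exact: mX].
rewrite EFinD muleDl// mul1e; apply: leeD; first exact: Vmoment_le_normV2.
by rewrite (le_trans hmom)// -NE -EFinM lee_fin mulrA.
Qed.

(** * Lower bound for the norm on the Nehari set *)

Lemma normV2_gt0 (V u g1 g2 : R * R -> R) : (forall z, 0 < V z) ->
  measurable_fun setT V -> measurable_fun setT u ->
  measurable_fun setT g1 -> measurable_fun setT g2 ->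
  ~ (\forall z \ae @leb2 R, u z = 0) -> (0 < normV2 V u g1 g2)%E.
Proof.
move=> V0 mV mu mg1 mg2 un0; rewrite lt_neqAle normV2_ge0// andbT.
apply/negP => /eqP N0; apply: un0.
have p0 z : 0 <= g1 z ^+ 2 + g2 z ^+ 2 by rewrite addr_ge0 ?sqr_ge0.
have q0 z : 0 <= V z * u z ^+ 2 by rewrite mulr_ge0 ?sqr_ge0// ltW.
have mN := measurable_normV2 mV mu mg1 mg2.
have pq0 z : 0 <= g1 z ^+ 2 + g2 z ^+ 2 + V z * u z ^+ 2 by rewrite addr_ge0.
have [A [mA A0 sA]] : \forall z \ae @leb2 R,
    g1 z ^+ 2 + g2 z ^+ 2 + V z * u z ^+ 2 = 0.
  by apply: ge0_integral0_ae => //; rewrite -[RHS]N0.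
exists A; split => // z nz; apply: sA => /= h; apply: nz.
have Vu : V z * u z ^+ 2 = 0 by apply/eqP; rewrite eq_le q0 andbT -h lerDr p0.
by apply/eqP; move/eqP: Vu; rewrite mulf_eq0 gt_eqF//= sqrf_eq0.
Qed.

Lemma L2norm2_le (V u g1 g2 : R * R -> R) (c : R) : 0 < c ->
  (forall z, c <= V z) ->
  measurable_fun setT V -> measurable_fun setT u ->
  measurable_fun setT g1 -> measurable_fun setT g2 ->
  (c%:E * L2norm2 u <= normV2 V u g1 g2)%E.
Proof.
move=> c0 cV mV mu mg1 mg2.
have mu2 : measurable_fun setT (fun z => (u z ^+ 2)%:E).
  by apply/measurable_EFinP; exact: measurable_funX.
have u20 z : (0 <= (u z ^+ 2)%:E)%E by rewrite lee_fin sqr_ge0.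
have V0 z : 0 < V z by exact: lt_le_trans (cV z).
apply: le_trans (Vmoment_le_normV2 V0 mV mu mg1 mg2).
rewrite /L2norm2 -ge0_integralZl//; last by rewrite lee_fin ltW.
apply: ge0_le_integral => //.
- by move=> z _; rewrite mule_ge0// lee_fin ltW.
- exact: measurable_funeM.
- by apply/measurable_EFinP; apply: measurable_funM => //; exact: measurable_funX.
- by move=> z _; rewrite -EFinM lee_fin ler_wpM2r// sqr_ge0.
Qed.

Lemma Nehari_normV2_ge (V : R * R -> R) (p C : R) : 1 < p -> C1 V ->
  (forall z, 0 < V z) ->
  (forall M : R, exists r : R, forall z, r < euclid_norm z -> M < V z) ->
  0 < C ->
  (\forall z \ae @leb2 R,
     Num.sqrt (dpart true V z ^+ 2 + dpart false V z ^+ 2)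
       <= C * powR (V z) (3 / 2)) ->
  exists2 d : R, 0 < d & forall u g1 g2, Nehari V p u g1 g2 ->
    (d%:E <= normV2 V u g1 g2)%E.
Proof.
move=> p1 C1V V0 coerV C0 aeV.
have cV : continuous V by case: C1V.
have mV : measurable_fun setT V by exact: continuous_measurable_fun_prod.
have [c c0 Vc] := coercive_lower_bound cV V0 coerV.
have [K K0 hK] := Vpow_bound p1 C1V V0 C0 aeV.
pose q := (p + 3) / (p + 1).
have q0 : 0 < q by rewrite divr_gt0//; lra.
(* Either [N > 1/4], or [N = q L W] with [c L <= N] and [W <= K N], so that [c N <= q K N^2];
   dividing by [N > 0] gives the second entry of the minimum. *)
exists (Num.min 4^-1 (c / (q * K))).
  by rewrite lt_min invr_gt0 ltr0n/= divr_gt0// mulr_gt0.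
move=> u g1 g2 [Hu [un0]].
have [mu [mg1 [mg2 _]]] := Hu.
have Npos := normV2_gt0 V0 mV mu mg1 mg2 un0.
have L2le := L2norm2_le c0 Vc mV mu mg1 mg2.
have L20 : (0 <= L2norm2 u)%E by apply: integral_ge0 => z _; rewrite lee_fin sqr_ge0.
have hKu := hK _ _ _ Hu Npos.
have Nfin : normV2 V u g1 g2 \is a fin_num.
  by rewrite ge0_fin_numE ?ltW// normV2_H1V_lty.
have W0 : (0 <= Vpow V p u)%E.
  by apply: integral_ge0 => z _; rewrite lee_fin mulr_ge0 ?powR_ge0// ltW.
rewrite -/q.
move: (normV2 V u g1 g2) (L2norm2 u) (Vpow V p u) Npos L2le L20 hKu Nfin W0.
move=> N L W Npos cLN L0 WKN Nfin W0 NE.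
rewrite EFin_min ge_min; apply/orP.
have [N4|N4] := leP N (4^-1)%:E; last by left; exact: ltW.
right; have {}WKN := WKN N4.
case: N Nfin Npos N4 cLN WKN NE => // N _; rewrite !lte_fin => N0 N4 cLN WKN NE.
(* An infinite [L] would contradict [c L <= N] with [N] finite. *)
have Lfin : L \is a fin_num.
  rewrite ge0_fin_numE//; case: L L0 cLN {NE} => [r| |] // _; first by rewrite ltry.
  by rewrite gt0_muley ?lte_fin.
have Wfin : W \is a fin_num by rewrite ge0_fin_numE// (le_lt_trans WKN)// -EFinM ltry.
case: L Lfin L0 cLN NE => // L _; case: W Wfin W0 WKN => // W _.
rewrite -!EFinM !lee_fin => W0 WKN L0 cLN [NE].
rewrite ler_pdivrMr; last exact: mulr_gt0.
have LW : c * (L * W) <= N * (K * N).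
  by rewrite mulrA ler_pM// mulr_ge0// ltW.
have : N * c <= N * (N * (q * K)).
  rewrite {1}NE (_ : q * (L * W) * c = q * (c * (L * W))); last by ring.
  rewrite (_ : N * (N * (q * K)) = q * (N * (K * N))); last by ring.
  by rewrite ler_pM2l.
by rewrite ler_pM2l.
Qed.

End Plane.

(** * Positivity of the infimum *)

Unset Implicit Arguments.

Theorem lemma3p4 (R : realType) (p : R) (V : R * R -> R) (C : R) :
  1 < p ->
  C1 V ->
  (forall z, 0 < V z) ->
  (forall M : R, exists r : R, forall z, r < euclid_norm z -> M < V z) ->
  0 < C ->
  (\forall z \ae @leb2 R,
     Num.sqrt (dpart true V z ^+ 2 + dpart false V z ^+ 2)
       <= C * powR (V z) (3 / 2)) ->
  (0 < ereal_inf [set x | exists u g1 g2, Nehari V p u g1 g2 /\ x = Ifun V p u g1 g2])%E.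
Proof.
move=> p1 C1V V0 coerV C0 aeV.
have [d d0 hd] := Nehari_normV2_ge p1 C1V V0 coerV C0 aeV.
(* On the Nehari set the product term is [(p + 1) / (p + 3) * N], so the functional is
   [(1/2 - 1/(p + 3)) N = m N]. *)
pose m := (p + 1) / (2 * (p + 3)).
have m0 : 0 < m by rewrite divr_gt0//; lra.
apply: (@lt_le_trans _ _ (m * d)%:E); first by rewrite lte_fin mulr_gt0.
apply: le_ereal_inf_tmp => _ [u [g1 [g2 [Nu ->]]]].
have dN := hd _ _ _ Nu; move: Nu => [Hu [_ NE]].
have Nfin : (normV2 V u g1 g2 < +oo)%E by apply: normV2_H1V_lty => //; case: C1V.
rewrite /Ifun; move: (normV2 V u g1 g2) (L2norm2 u * Vpow V p u)%E dN NE Nfin.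
have q0 : 0 < (p + 3) / (p + 1) by rewrite divr_gt0//; lra.
(* As [N] is finite and its coefficient in the Nehari identity is positive, the product [X] cannot
   be infinite. *)
case=> // N [X| |] dN NE _; last 2 first.
- by move: NE; rewrite gt0_muley ?lte_fin.
- by move: NE; rewrite gt0_muleNy ?lte_fin.
move: NE; rewrite -EFinM => -[NE].
have -> : X = (p + 1) / (p + 3) * N.
  by rewrite NE; field; apply/andP; split; apply/lt0r_neq0; lra.
rewrite -!EFinM -EFinB lee_fin.
have -> : 2^-1 * N - (p + 1)^-1 * ((p + 1) / (p + 3) * N) = m * N.
  by rewrite /m; field; apply/andP; split; apply/lt0r_neq0; lra.
by rewrite ler_pM2l// -lee_fin.
Qed.
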